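(* Let $r\ge3$. Let $\gamma$ be a $3$-Frenet helix, with constant curvatures $\kappa,\tau$, parametrized by the arc length $s$ in a non flat semi-Riemannian space form $N^3_1(c)$ (so $c\ne0$). (i) If $c>0$ and the normal vector field $N$ is space-like, then $\gamma$ is a proper $r$-harmonic curve if and only if at least one of the following holds: $r>3$ and $\kappa^2=\tau^2$; or (a) $\kappa^2\ge c(r-1)$ and $\tau^2=\dfrac{2\kappa^2-c\pm\sqrt{c^2+4c(r-2)\kappa^2}}{2}$ (for one of the two choices of sign); or (b) $\kappa^2<c(r-1)$ and $\tau^2=\dfrac{2\kappa^2-c+\sqrt{c^2+4c(r-2)\kappa^2}}{2}$. (ii) If $c>0$ and the normal vector field $N$ is time-like, then $\gamma$ cannot be proper $r$-harmonic (for any $r\ge3$). (iii) If $c<0$ and the normal vector field $N$ is space-like, then $\gamma$ is a proper $r$-harmonic curve if and only if at least one of the following holds: $r>3$ and $\kappa^2=\tau^2$; or $$\kappa^2\le-\frac{c}{4(r-2)}\quad\text{and}\quad\tau^2=\frac{2\kappa^2-c\pm\sqrt{c^2+4c(r-2)\kappa^2}}{2}$$ (for one of the two choices of sign). (iv) If $c<0$ and the normal vector field $N$ is time-like, then $\gamma$ is a proper $r$-harmonic curve if and only if $$\kappa^2\le-c(r-1)\quad\text{and}\quad\tau^2=\frac{-2\kappa^2-c+\sqrt{c^2-4c(r-2)\kappa^2}}{2}.$$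
   Context: Conventions. For a semi-Riemannian manifold $(M,\langle\,,\rangle)$ with Levi-Civita connection $\nabla$, $R(X,Y)Z=\nabla_X\nabla_YZ-\nabla_Y\nabla_XZ-\nabla_{[X,Y]}Z$. Curves $\gamma:I\to M$ ($I$ an open real interval) are smooth, nonnull, parametrized by arc length; $T=\gamma'$. Put $\nabla_T^0T=T$, $\nabla_T^jT=\nabla_T(\nabla_T^{j-1}T)$. For $r\ge2$, $\gamma$ is $r$-harmonic if $$\tau_r(\gamma)=\nabla^{2r-1}_T T+\sum_{\ell=0}^{r-2}(-1)^\ell R\big(\nabla^{2r-3-\ell}_T T,\nabla^{\ell}_T T\big)T=0,$$ and proper $r$-harmonic if it is $r$-harmonic and not a geodesic. A $3$-Frenet curve in the $3$-dimensional ambient space is a curve admitting a frame $\{T,N,B\}$ along it with $\langle T,T\rangle=\epsilon_1$, $\langle N,N\rangle=\epsilon_2$, $\langle B,B\rangle=\epsilon_3$, each $\pm1$, mutually orthogonal, and $\nabla_TT=\epsilon_2kN$, $\nabla_TN=-\epsilon_1kT+\epsilon_3\tau B$, $\nabla_TB=-\epsilon_2\tau N$, where $k(s)>0$ and $\tau(s)$ is positive (or real valued when the space is oriented, $B$ being then chosen so that $\{T,N,B\}$ is positively oriented). It is a helix if the curvatures are constant, denoted $\kappa,\tau$. $N$ is space-like if $\epsilon_2=1$, time-like if $\epsilon_2=-1$. Let $\mathbb{R}^4_t$ be $\mathbb{R}^4$ with $\langle x,y\rangle=-\sum_{i=1}^t x_iy_i+\sum_{i=t+1}^4 x_iy_i$.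 $N^3_1(c)$ denotes $\{x\in\mathbb{R}^{4}_1:\langle x,x\rangle=1/c\}$ if $c>0$ and $\{x\in\mathbb{R}^{4}_{2}:\langle x,x\rangle=1/c\}$ if $c<0$, with the induced metric of index $1$; its curvature is $R(X,Y)Z=c(\langle Y,Z\rangle X-\langle X,Z\rangle Y)$. *)

(* Defs.v *)
From HB Require Import structures.
From mathcomp Require Import all_boot all_order all_algebra.
From mathcomp Require Import all_classical all_reals all_analysis.

Set Implicit Arguments.
Unset Strict Implicit.
Unset Printing Implicit Defensive.

Import Order.TTheory GRing.Theory Num.Theory.
Import numFieldNormedType.Exports.

Local Open Scope classical_set_scope.
Local Open Scope ring_scope.

(* The scalar product of R^4_t. *)
Definition sprod (R : realType) (t : nat) (x y : 'rV[R]_4) : R :=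
  - (\sum_(i < 4 | (i < t)%N) x 0 i * y 0 i)
  + \sum_(i < 4 | (t <= i)%N) x 0 i * y 0 i.

(* Index of the flat ambient space containing N^3_1(c); only meaningful for
   c != 0. *)
Definition ambient_index (R : realType) (c : R) : nat :=
  if 0 < c then 1%N else 2%N.

Definition inner (R : realType) (c : R) : 'rV[R]_4 -> 'rV[R]_4 -> R :=
  sprod (ambient_index c).

Definition space_form (R : realType) (c : R) : set 'rV[R]_4 :=
  [set x | inner c x x = c^-1].

(* The tangent space of N^3_1(c) at p is the orthogonal complement of p. *)
Definition tangent (R : realType) (c : R) (p v : 'rV[R]_4) : Prop :=
  inner c v p = 0.

(* Orthogonal projection onto the tangent space at p. *)
Definition tproj (R : realType) (c : R) (p v : 'rV[R]_4) : 'rV[R]_4 :=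
  v - (inner c v p / inner c p p) *: p.

(* Covariant derivative along gamma of a vector field V along gamma.  The
   Levi-Civita connection of the metric induced on N^3_1(c) is the tangential
   part of the flat connection of the ambient space (Gauss formula). *)
Definition nabla (R : realType) (c : R) (gamma V : R -> 'rV[R]_4) :
    R -> 'rV[R]_4 :=
  fun s => tproj c (gamma s) (derive1 V s).

Definition velocity (R : realType) (gamma : R -> 'rV[R]_4) : R -> 'rV[R]_4 :=
  derive1 gamma.

Definition nablaT (R : realType) (c : R) (j : nat) (gamma : R -> 'rV[R]_4) :
    R -> 'rV[R]_4 :=
  iter j (nabla c gamma) (velocity gamma).

(* Curvature tensor R(X,Y)Z of N^3_1(c), with the convention
   R(X,Y)Z = nabla_X nabla_Y Z - nabla_Y nabla_X Z - nabla_[X,Y] Z. *)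
Definition curvature (R : realType) (c : R) (X Y Z : 'rV[R]_4) : 'rV[R]_4 :=
  c *: (inner c Y Z *: X - inner c X Z *: Y).

(* For r >= 2; all natural-number subtractions are then exact. *)
Definition rtension (R : realType) (c : R) (r : nat) (gamma : R -> 'rV[R]_4)
    (s : R) : 'rV[R]_4 :=
  nablaT c (2 * r - 1) gamma s
  + \sum_(0 <= l < r - 1)
      (-1) ^+ l *: curvature c (nablaT c (2 * r - 3 - l) gamma s)
                               (nablaT c l gamma s)
                               (velocity gamma s).

Definition r_harmonic (R : realType) (c : R) (r : nat) (I : set R)
    (gamma : R -> 'rV[R]_4) : Prop :=
  forall s, I s -> rtension c r gamma s = 0.

Definition geodesic (R : realType) (c : R) (I : set R)
    (gamma : R -> 'rV[R]_4) : Prop :=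
  forall s, I s -> nabla c gamma (velocity gamma) s = 0.

Definition proper_r_harmonic (R : realType) (c : R) (r : nat) (I : set R)
    (gamma : R -> 'rV[R]_4) : Prop :=
  r_harmonic c r I gamma /\ ~ geodesic c I gamma.

Definition open_interval (R : realType) (I : set R) : Prop :=
  [/\ open I, is_interval I & I !=set0].

Definition smooth_on (R : realType) (I : set R) (f : R -> 'rV[R]_4) : Prop :=
  forall (n : nat) (s : R), I s -> derivable (derive1n n f) s 1.

Definition is_sign (R : realType) (e : R) : Prop := e = 1 \/ e = -1.

(* The torsion is real valued and no orientation is imposed: replacing
   (B, tau) by (- B, - tau) gives another frame, so this covers both
   the convention tau > 0 and the convention of a positively oriented frame,
   for either orientation of N^3_1(c). *)
Record frenet3 (R : realType) (c : R) (I : set R)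
    (gamma N B : R -> 'rV[R]_4) (e1 e2 e3 : R) (k tau : R -> R) : Prop :=
  Frenet3 {
    frenet_domain : open_interval I;
    frenet_smooth : smooth_on I gamma;
    frenet_smoothN : smooth_on I N;
    frenet_smoothB : smooth_on I B;
    frenet_in : forall s, I s -> space_form c (gamma s);
    frenet_tangentN : forall s, I s -> tangent c (gamma s) (N s);
    frenet_tangentB : forall s, I s -> tangent c (gamma s) (B s);
    frenet_sign1 : is_sign e1;
    frenet_sign2 : is_sign e2;
    frenet_sign3 : is_sign e3;
    frenet_TT : forall s, I s -> inner c (velocity gamma s) (velocity gamma s) = e1;
    frenet_NN : forall s, I s -> inner c (N s) (N s) = e2;
    frenet_BB : forall s, I s -> inner c (B s) (B s) = e3;
    frenet_TN : forall s, I s -> inner c (velocity gamma s) (N s) = 0;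
    frenet_TB : forall s, I s -> inner c (velocity gamma s) (B s) = 0;
    frenet_NB : forall s, I s -> inner c (N s) (B s) = 0;
    frenet_k_gt0 : forall s, I s -> 0 < k s;
    frenet_dT : forall s, I s ->
      nabla c gamma (velocity gamma) s = (e2 * k s) *: N s;
    frenet_dN : forall s, I s ->
      nabla c gamma N s
      = - (e1 * k s) *: velocity gamma s + (e3 * tau s) *: B s;
    frenet_dB : forall s, I s ->
      nabla c gamma B s = - (e2 * tau s) *: N s
  }.

Definition helix3 (R : realType) (c : R) (I : set R)
    (gamma N B : R -> 'rV[R]_4) (e1 e2 e3 kappa tau : R) : Prop :=
  frenet3 c I gamma N B e1 e2 e3 (fun=> kappa) (fun=> tau).

(* Main.v *)
(* Along a helix, nabla_T acts on span(T, N, B) with constant coefficients, and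
   nabla_T^(j+2) T = - omega nabla_T^j T for j >= 1, where
   omega = e1 e2 kappa^2 + e2 e3 tau^2.  All curvature terms of the r-tension
   field with l >= 1 then coincide, and the r-tension field is
   e2 kappa (- omega)^(r-3) (omega^2 - c e1 omega - c e2 (r-2) kappa^2) N.
   Comparing the Gram determinant of (T, N, B, gamma) with that of the ambient
   metric gives e1 e2 e3 = -1, so that e1 drops out and what remains is a
   quadratic equation in tau^2. *)
Require Import Defs.
From HB Require Import structures.
From mathcomp Require Import all_boot all_order all_algebra.
From mathcomp Require Import all_classical all_reals all_analysis.
From mathcomp Require Import zify ring lra.

Set Implicit Arguments.
Unset Strict Implicit.
Unset Printing Implicit Defensive.

Import Order.TTheory GRing.Theory Num.Theory.
Import numFieldNormedType.Exports.

Local Open Scope classical_set_scope.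
Local Open Scope ring_scope.

(** * Scalar product, tangential projection and Gram matrices *)

Section Inner.
Variables (R : realType) (c : R).
Implicit Types (a : R) (p x y z : 'rV[R]_4).

Lemma innerC x y : inner c x y = inner c y x.
Proof.
by rewrite /inner /sprod; congr (- _ + _); apply: eq_bigr => i _; rewrite mulrC.
Qed.

Lemma innerDl x y z : inner c (x + y) z = inner c x z + inner c y z.
Proof.
rewrite /inner /sprod addrACA -opprD -!big_split.
by congr (- _ + _); apply: eq_bigr => i _; rewrite mxE mulrDl.
Qed.

Lemma innerZl a x y : inner c (a *: x) y = a * inner c x y.
Proof.
rewrite /inner /sprod mulrDr mulrN !mulr_sumr.
by congr (- _ + _); apply: eq_bigr => i _; rewrite mxE mulrA.
Qed.

Lemma inner0l x : inner c 0 x = 0.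
Proof. by rewrite -(scale0r 0) innerZl mul0r. Qed.

Lemma tproj_tangent p v : inner c p p != 0 -> tangent c p (tproj c p v).
Proof.
move=> p0; rewrite /tangent /tproj -scaleNr innerDl innerZl mulNr divfK //.
exact: subrr.
Qed.

Lemma tprojD p x y : tproj c p (x + y) = tproj c p x + tproj c p y.
Proof. by rewrite /tproj innerDl mulrDl scalerDl opprD addrACA. Qed.

Lemma tprojZ p a x : tproj c p (a *: x) = a *: tproj c p x.
Proof. by rewrite /tproj innerZl -mulrA -scalerA scalerBr. Qed.

Definition metric_mx : 'M[R]_4 :=
  diag_mx (\row_i (-1) ^+ (i < ambient_index c)%N).

(** Makes Gram matrices into matrix products, so that their determinants factor. *)
Lemma inner_mx m n (A : 'M[R]_(m, 4)) (B : 'M[R]_(n, 4)) i j :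
  (A *m metric_mx *m B^T) i j = inner c (row i A) (row j B).
Proof.
rewrite mul_mx_diag mxE /inner /sprod.
rewrite (bigID (fun k : 'I_4 => (k < ambient_index c)%N)) /= -sumrN.
congr (_ + _); first by apply: eq_bigr => k kt; rewrite !mxE kt mulrN1 mulNr.
apply: eq_big => k; first by rewrite -leqNgt.
by move=> /negbTE kt; rewrite !mxE kt mulr1.
Qed.

Lemma det_metric_mx : \det metric_mx = (-1) ^+ ambient_index c.
Proof.
rewrite det_diag !big_ord_recl big_ord0 !mxE /ambient_index.
by case: ifP => _ /=; rewrite ?expr0 ?mulr1 ?expr1 ?expr2.
Qed.

End Inner.

(** * Locality and linearity of the covariant derivative along a curve *)

Section Nabla.
Variables (R : realType) (c : R) (I : set R) (gamma : R -> 'rV[R]_4).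
Implicit Types (a b : R) (V W : R -> 'rV[R]_4).

(** The Frenet formulas hold only on [I]; as [I] is open, they can still be differentiated there. *)
Lemma eq_nabla V W s : open I -> I s -> (forall u, I u -> V u = W u) ->
  nabla c gamma V s = nabla c gamma W s.
Proof.
move=> oI Is VW; rewrite /nabla !derive1E; congr tproj.
apply: near_eq_derive.
by near=> u; apply: VW; near: u; exact: open_nbhs_nbhs.
Unshelve. all: by end_near. Qed.

Lemma nablaZ a V s : derivable V s 1 ->
  nabla c gamma (fun u => a *: V u) s = a *: nabla c gamma V s.
Proof.
by move=> dV; rewrite /nabla !derive1E deriveZ // tprojZ.
Qed.

Lemma nabla_lin a b V W s : derivable V s 1 -> derivable W s 1 ->
  nabla c gamma (fun u => a *: V u + b *: W u) s =
  a *: nabla c gamma V s + b *: nabla c gamma W s.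
Proof.
move=> dV dW; rewrite /nabla !derive1E.
have daV : derivable (a \*: V) s 1 by exact: derivableZ.
have dbW : derivable (b \*: W) s 1 by exact: derivableZ.
have -> : 'D_1 (fun u => a *: V u + b *: W u) s =
    'D_1 (a \*: V) s + 'D_1 (b \*: W) s by exact: deriveD daV dbW.
by rewrite deriveZ // deriveZ // tprojD !tprojZ.
Qed.

End Nabla.

(** * The [r]-tension field of a helix *)

Section Helix.
Variables (R : realType) (c : R) (I : set R) (gamma N B : R -> 'rV[R]_4).
Variables (e1 e2 e3 kappa tau : R).
Hypothesis c0 : c != 0.
Hypothesis hel : helix3 c I gamma N B e1 e2 e3 kappa tau.

(** [nabla c gamma N] is tangent as a projection and [B] is tangent, so the Frenet formula for [N]
    makes a nonzero multiple of the velocity tangent. *)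
Lemma helix_velocity_tangent s : I s -> tangent c (gamma s) (velocity gamma s).
Proof.
move=> Is; have k0 : 0 < kappa := frenet_k_gt0 hel Is.
have g0 : inner c (gamma s) (gamma s) != 0.
  by have := frenet_in hel Is; rewrite /space_form /= => ->; rewrite invr_eq0.
have := tproj_tangent (derive1 N s) g0.
rewrite -/(nabla c gamma N s) (frenet_dN hel Is) /tangent innerDl !innerZl.
have -> : inner c (B s) (gamma s) = 0 by exact: (frenet_tangentB hel Is).
rewrite mulr0 addr0 => /eqP; rewrite mulf_eq0 oppr_eq0 mulf_eq0 (gt_eqF k0) orbF.
have /negbTE -> : e1 != 0.
  by case: (frenet_sign1 hel) => ->; rewrite ?oppr_eq0 oner_neq0.
by move=> /eqP.
Qed.

(* The Gram matrix of the orthogonal frame (T, N, B, gamma) is congruent to the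
   ambient metric, so their determinants have the same sign. *)
Lemma helix_signs : e1 * e2 * e3 = -1.
Proof.
have [_ _ [s Is]] := frenet_domain hel.
pose F : 'M[R]_4 := \matrix_(i < 4)
  nth 0 [:: velocity gamma s; N s; B s; gamma s] i.
have TN := frenet_TN hel Is; have TB := frenet_TB hel Is.
have NB := frenet_NB hel Is.
have Ng : inner c (N s) (gamma s) = 0 := frenet_tangentN hel Is.
have Bg : inner c (B s) (gamma s) = 0 := frenet_tangentB hel Is.
have Tg : inner c (velocity gamma s) (gamma s) = 0 := helix_velocity_tangent Is.
have gg : inner c (gamma s) (gamma s) = c^-1 := frenet_in hel Is.
have gram : F *m metric_mx c *m F^T =
    diag_mx (\row_i nth 0 [:: e1; e2; e3; c^-1] i).
  apply/matrixP => i j; rewrite inner_mx !rowK !mxE.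
  case: i => [[|[|[|[|//]]]] ?]; case: j => [[|[|[|[|//]]]] ?] //=;
    rewrite ?(frenet_TT hel Is) ?(frenet_NN hel Is) ?(frenet_BB hel Is) ?gg //;
    by rewrite ?mulr0n // innerC.
have := congr1 determinant gram.
rewrite !detM det_tr det_metric_mx det_diag !big_ord_recl big_ord0 !mxE /=.
have sgn : e1 * e2 * e3 = 1 \/ e1 * e2 * e3 = -1.
  case: (frenet_sign1 hel) => ->; case: (frenet_sign2 hel) => ->;
  case: (frenet_sign3 hel) => ->; rewrite !(mulr1, mul1r, mulrN1, opprK); auto.
(* With product [1] the determinants would give [- (\det F) ^+ 2 = c^-1] for [c > 0] and
   [(\det F) ^+ 2 = c^-1] for [c < 0], both of the wrong sign. *)
case: sgn => // e; rewrite mulr1 !mulrA e mul1r => detE; exfalso.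
have : 0 <= (\det F) ^+ 2 by exact: sqr_ge0.
move: detE; rewrite /ambient_index; case: ifP => cp.
  by rewrite expr1 => detE; have := cp; rewrite -invr_gt0; nra.
have cn : c < 0 by rewrite lt_neqAle c0 leNgt cp.
by rewrite sqrrN expr1n => detE; have := cn; rewrite -invr_lt0; nra.
Qed.

Let omega := e1 * e2 * kappa ^+ 2 + e2 * e3 * tau ^+ 2.

Let e1sq : e1 ^+ 2 = 1.
Proof. by case: (frenet_sign1 hel) => ->; rewrite ?sqrrN expr1n. Qed.

Let e2sq : e2 ^+ 2 = 1.
Proof. by case: (frenet_sign2 hel) => ->; rewrite ?sqrrN expr1n. Qed.

(** [N] is an eigenvector of the squared covariant derivative, with eigenvalue [- omega]. The
    pattern starts at order 1 because the velocity is an eigenvector only if [tau = 0]. *)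
Lemma helix_nablaT j s : I s ->
  nablaT c j.*2.+1 gamma s = ((- omega) ^+ j * (e2 * kappa)) *: N s /\
  nablaT c j.*2.+2 gamma s =
    ((- omega) ^+ j * - (e1 * e2 * kappa ^+ 2)) *: velocity gamma s
    + ((- omega) ^+ j * (e2 * e3 * kappa * tau)) *: B s.
Proof.
have [oI _ _] := frenet_domain hel.
have even_of_odd i : (forall u, I u ->
    nablaT c i.*2.+1 gamma u = ((- omega) ^+ i * (e2 * kappa)) *: N u) ->
  forall u, I u -> nablaT c i.*2.+2 gamma u =
    ((- omega) ^+ i * - (e1 * e2 * kappa ^+ 2)) *: velocity gamma u
    + ((- omega) ^+ i * (e2 * e3 * kappa * tau)) *: B u.
  move=> oddE u Iu; rewrite /nablaT iterS (eq_nabla _ _ oI Iu oddE).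
  rewrite nablaZ; last exact: (frenet_smoothN hel (n := 0%N) Iu).
  rewrite (frenet_dN hel Iu) scalerDr !scalerA.
  by congr (_ *: _ + _ *: _); ring.
elim: j s => [|j IH] s Is.
  have odd0 u : I u ->
      nablaT c 1 gamma u = ((- omega) ^+ 0 * (e2 * kappa)) *: N u.
    by move=> Iu; rewrite mul1r -(frenet_dT hel Iu).
  by split; [exact: odd0 | exact: even_of_odd].
have oddE u : I u -> nablaT c j.+1.*2.+1 gamma u =
    ((- omega) ^+ j.+1 * (e2 * kappa)) *: N u.
  move=> Iu; rewrite /nablaT doubleS iterS.
  rewrite (eq_nabla _ _ oI Iu (fun v Iv => (IH v Iv).2)).
  rewrite nabla_lin; last 2 first.
  - exact: (frenet_smooth hel (n := 1%N) Iu).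
  - exact: (frenet_smoothB hel (n := 0%N) Iu).
  rewrite (frenet_dT hel Iu) (frenet_dB hel Iu) !scalerA -scalerDl.
  by congr (_ *: _); rewrite (exprS _ j) /omega; ring.
by split; [exact: oddE | exact: even_of_odd].
Qed.

(** The two orders have odd sum, so one derivative is a multiple of [N] and the other lies in the
    span of the velocity and [B]; only the velocity component contributes. The sign [(-1) ^+ l]
    cancels the antisymmetry of the curvature. *)
Lemma helix_curvature r l s : I s -> (l <= r.+1)%N -> (0 < l)%N ->
  (-1) ^+ l *: curvature c (nablaT c (2 * r.+3 - 3 - l) gamma s)
                 (nablaT c l gamma s) (velocity gamma s) =
  (- (c * e2 * kappa ^+ 2) * (- omega) ^+ r * (e2 * kappa)) *: N s.
Proof.
move=> Is lr l0.
have innerNT : inner c (N s) (velocity gamma s) = 0.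
  by rewrite innerC (frenet_TN hel Is).
have innerBT : inner c (B s) (velocity gamma s) = 0.
  by rewrite innerC (frenet_TB hel Is).
have TT := frenet_TT hel Is.
have := odd_double_half l; case: (odd l); rewrite ?(add1n, add0n) => lE.
  pose j := l./2.
  have -> : (2 * r.+3 - 3 - l)%N = (r - j).*2.+2 by lia.
  have -> : l = j.*2.+1 by lia.
  have -> : (- omega) ^+ r = (- omega) ^+ (r - j) * (- omega) ^+ j.
    by rewrite -exprD subnK //; lia.
  rewrite (helix_nablaT j Is).1 (helix_nablaT (r - j) Is).2 /curvature.
  rewrite innerDl !innerZl innerNT innerBT TT (exprS _ j.*2) -mul2n exprM sqrrN !expr1n.
  rewrite !(mulr0, addr0, scale0r, sub0r, scalerN, scalerA) -scaleNr.
  (* One [e1] is the square of the velocity, the other sits in its coefficient; [e1 ^+ 2 = 1]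
     removes both. *)
  congr (_ *: _); rewrite -[RHS]mul1r -[X in _ = X * _]e1sq; ring.
(* Here [l] is even and positive, hence at least 2, so the predecessor is exact. *)
pose j := (l./2).-1.
have -> : (2 * r.+3 - 3 - l)%N = (r - j).*2.+1 by lia.
have -> : l = j.*2.+2 by lia.
have -> : (- omega) ^+ r = (- omega) ^+ (r - j) * (- omega) ^+ j.
  by rewrite -exprD subnK //; lia.
rewrite (helix_nablaT j Is).2 (helix_nablaT (r - j) Is).1 /curvature.
rewrite innerDl !innerZl innerNT innerBT TT (exprS _ j.*2.+1) (exprS _ j.*2) -mul2n exprM sqrrN !expr1n.
rewrite !(mulr0, addr0, scale0r, subr0, scalerN, scalerA).
congr (_ *: _); rewrite -[RHS]mul1r -[X in _ = X * _]e1sq; ring.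
Qed.

Lemma helix_rtension r s : I s -> rtension c r.+3 gamma s =
  (e2 * kappa * (- omega) ^+ r *
   (omega ^+ 2 - c * e1 * omega - c * e2 * r.+1%:R * kappa ^+ 2)) *: N s.
Proof.
move=> Is; rewrite /rtension.
have -> : (2 * r.+3 - 1)%N = r.+2.*2.+1 by lia.
have -> : (r.+3 - 1)%N = r.+2 by lia.
(* The term [l = 0] is split off: its second argument is the velocity itself, outside the pattern of
   [helix_nablaT]. *)
rewrite (helix_nablaT _ Is).1 big_ltn // subn0 expr0 scale1r.
have -> : (2 * r.+3 - 3)%N = r.+1.*2.+1 by lia.
rewrite (eq_big_nat _ _ (F2 := fun=>
    (- (c * e2 * kappa ^+ 2) * (- omega) ^+ r * (e2 * kappa)) *: N s)); last first.
  move=> l /andP[l0 lr].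
  have -> : r.+1.*2.+1 = (2 * r.+3 - 3)%N by lia.
  exact: helix_curvature.
rewrite sumr_const_nat subSS subn0 (helix_nablaT _ Is).1 /curvature.
rewrite innerZl (innerC _ (N s)) (frenet_TN hel Is) mulr0 scale0r subr0.
rewrite /nablaT /= (frenet_TT hel Is) -scaler_nat !scalerA -!scalerDl.
by congr (_ *: _); rewrite !exprS; ring.
Qed.

Lemma helix_normal_neq0 s : I s -> N s != 0.
Proof.
move=> Is; apply/eqP => N0; have := frenet_NN hel Is.
rewrite N0 inner0l => e20; move: e2sq; rewrite -e20 expr0n => /eqP.
by rewrite eq_sym oner_eq0.
Qed.

Lemma helix_not_geodesic : ~ geodesic c I gamma.
Proof.
have [_ _ [s Is]] := frenet_domain hel; move=> /(_ s Is) /eqP.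
rewrite (frenet_dT hel Is) scaler_eq0 (negbTE (helix_normal_neq0 Is)) orbF.
rewrite mulf_eq0 (gt_eqF (frenet_k_gt0 hel Is)) orbF => /eqP e20.
by move: e2sq; rewrite e20 expr0n => /eqP; rewrite eq_sym oner_eq0.
Qed.

(* Since e1 e2 e3 = -1, the two values of e1 give the same equation. *)
Lemma helix_proper_r_harmonic r : proper_r_harmonic c r.+3 I gamma <->
  (0 < r)%N /\ kappa ^+ 2 = e2 * tau ^+ 2 \/
  (kappa ^+ 2 - e2 * tau ^+ 2) ^+ 2 - c * e2 * (kappa ^+ 2 - e2 * tau ^+ 2)
    - c * e2 * r.+1%:R * kappa ^+ 2 = 0.
Proof.
have e3E : e3 = - (e1 * e2).
  rewrite -mulrN1 -helix_signs.
  have -> : e1 * e2 * (e1 * e2 * e3) = e1 ^+ 2 * e2 ^+ 2 * e3 by ring.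
  by rewrite e1sq e2sq !mul1r.
pose d := kappa ^+ 2 - e2 * tau ^+ 2.
have omegaE : omega = e1 * e2 * d.
  by rewrite /omega /d e3E; ring.
have quadE : omega ^+ 2 - c * e1 * omega = d ^+ 2 - c * e2 * d.
  rewrite omegaE !exprMn e1sq e2sq !mul1r; congr (_ - _).
  by rewrite -[RHS]mul1r -[X in _ = X * _]e1sq; ring.
have e20 : e2 != 0 by rewrite -sqrf_eq0 e2sq oner_eq0.
have e10 : e1 != 0 by rewrite -sqrf_eq0 e1sq oner_eq0.
have [_ _ [s0 Is0]] := frenet_domain hel.
have k0 : 0 < kappa := frenet_k_gt0 hel Is0.
(* The factor [(- omega) ^+ r] can vanish only for [0 < r]; the order being [r.+3], this is the
   extra case of order above 3. *)
have key s : I s -> (rtension c r.+3 gamma s == 0) =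
    (0 < r)%N && (d == 0) ||
    (d ^+ 2 - c * e2 * d - c * e2 * r.+1%:R * kappa ^+ 2 == 0).
  move=> Is; rewrite (helix_rtension r Is) scaler_eq0.
  rewrite (negbTE (helix_normal_neq0 Is)) orbF quadE !mulf_eq0 (negbTE e20).
  by rewrite (gt_eqF k0) expf_eq0 oppr_eq0 omegaE !mulf_eq0 (negbTE e20) (negbTE e10).
split=> [[/(_ s0 Is0) /eqP]|H].
  rewrite key // => /orP[/andP[r0 /eqP d0]|/eqP ?]; [left|by right].
  by split=> //; apply/eqP; rewrite -subr_eq0 -/d d0.
split; last exact: helix_not_geodesic.
move=> s Is; apply/eqP; rewrite key //; case: H => [[-> E]|->].
  by rewrite /d E subrr eqxx.
by rewrite eqxx orbT.
Qed.

End Helix.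

(** * Real roots of the quadratic equation in the squared torsion *)

Lemma quadratic_rootP (R : rcfType) (p q x : R) :
  x ^+ 2 - p * x + q = 0 <->
  0 <= p ^+ 2 - 4 * q /\ (x = (p + Num.sqrt (p ^+ 2 - 4 * q)) / 2 \/
                          x = (p - Num.sqrt (p ^+ 2 - 4 * q)) / 2).
Proof.
split=> [E|[/sqr_sqrtr]].
  (* Completing the square; the sign of [2 * x - p] then selects the root. *)
  have D : p ^+ 2 - 4 * q = (2 * x - p) ^+ 2 by lra.
  rewrite D sqrtr_sqr; split; first exact: sqr_ge0.
  by case: (ger0P (2 * x - p)) => _; [left|right]; field.
set u := Num.sqrt _ => uE [] -> ; lra.
Qed.

Section Roots.
Variables (R : rcfType) (c n K t : R).

(** Here [K], [t] and [n] stand for the squared curvature, the squared torsion and [r - 2]. In [t]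
    the roots have sum [2 * K - c] and product [K * (K - c * (n + 1))]. *)
Lemma spacelike_rootP : (K - t) ^+ 2 - c * (K - t) - c * n * K = 0 <->
  0 <= c ^+ 2 + 4 * c * n * K /\
  (t = (2 * K - c + Num.sqrt (c ^+ 2 + 4 * c * n * K)) / 2 \/
   t = (2 * K - c - Num.sqrt (c ^+ 2 + 4 * c * n * K)) / 2).
Proof.
have := quadratic_rootP (2 * K - c) (K ^+ 2 - c * (n + 1) * K) t.
have -> : (2 * K - c) ^+ 2 - 4 * (K ^+ 2 - c * (n + 1) * K) =
  c ^+ 2 + 4 * c * n * K by ring.
by congr (_ = 0 <-> _); ring.
Qed.

(** The discriminant is nonnegative, and [c * (n + 1)] is the value of [K] at which the product of
    the roots changes sign. *)
Lemma spacelike_roots_gt0 : 1 <= n -> 0 < K -> 0 <= t -> 0 < c ->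
  (K - t) ^+ 2 - c * (K - t) - c * n * K = 0 <->
  K >= c * (n + 1) /\
    (t = (2 * K - c + Num.sqrt (c ^+ 2 + 4 * c * n * K)) / 2 \/
     t = (2 * K - c - Num.sqrt (c ^+ 2 + 4 * c * n * K)) / 2) \/
  K < c * (n + 1) /\
    t = (2 * K - c + Num.sqrt (c ^+ 2 + 4 * c * n * K)) / 2.
Proof.
move=> n1 K0 t0 c_gt0; have D0 : 0 <= c ^+ 2 + 4 * c * n * K.
  by rewrite addr_ge0 ?sqr_ge0 // !mulr_ge0 //; lra.
split=> [E|[[_ root]|[_ root]]]; last 2 first.
- exact: spacelike_rootP.2.
- by apply: spacelike_rootP.2; split=> //; left.
have [_ root] := spacelike_rootP.1 E.
have [large|small] := lerP (c * (n + 1)) K; [by left | right].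
split=> //; case: root => // tE; exfalso.
(* The product of the roots is negative, but t >= 0 is the smaller one. *)
have u0 := sqrtr_ge0 (c ^+ 2 + 4 * c * n * K).
have : 0 <= t * (2 * K - c - t) by apply: mulr_ge0 => //; lra.
have : 0 < K * (c * (n + 1) - K) by rewrite mulr_gt0 ?subr_gt0.
by clear tE u0; lra.
Qed.

(** The bound on [K] is exactly the nonnegativity of the discriminant. *)
Lemma spacelike_roots_lt0 : 1 <= n -> c < 0 ->
  (K - t) ^+ 2 - c * (K - t) - c * n * K = 0 <->
  K <= - (c / (4 * n)) /\
    (t = (2 * K - c + Num.sqrt (c ^+ 2 + 4 * c * n * K)) / 2 \/
     t = (2 * K - c - Num.sqrt (c ^+ 2 + 4 * c * n * K)) / 2).
Proof.
move=> n1 c_lt0.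
have DE : (0 <= c ^+ 2 + 4 * c * n * K) = (K <= - (c / (4 * n))).
  have -> : c ^+ 2 + 4 * c * n * K = (- c * (4 * n)) * (- (c / (4 * n)) - K).
    by field; lra.
  by rewrite pmulr_rge0 ?subr_ge0 // mulr_gt0 //; lra.
by rewrite -DE; exact: spacelike_rootP.
Qed.

Lemma timelike_no_root : 1 <= n -> 0 < K -> 0 <= t -> 0 < c ->
  (K + t) ^+ 2 + c * (K + t) + c * n * K != 0.
Proof.
move=> n1 K0 t0 c_gt0; apply: lt0r_neq0; apply: ltr_wpDl; last first.
  by rewrite !mulr_gt0 //; lra.
by rewrite addr_ge0 ?sqr_ge0 // mulr_ge0 //; lra.
Qed.

Lemma timelike_roots_lt0 : 1 <= n -> 0 < K -> 0 <= t -> c < 0 ->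
  (K + t) ^+ 2 + c * (K + t) + c * n * K = 0 <->
  K <= - c * (n + 1) /\
    t = (- 2 * K - c + Num.sqrt (c ^+ 2 - 4 * c * n * K)) / 2.
Proof.
move=> n1 K0 t0 c_lt0.
have := quadratic_rootP (- 2 * K - c) (K ^+ 2 + c * (n + 1) * K) t.
have -> : (- 2 * K - c) ^+ 2 - 4 * (K ^+ 2 + c * (n + 1) * K) =
  c ^+ 2 - 4 * c * n * K by ring.
have -> : t ^+ 2 - (- 2 * K - c) * t + (K ^+ 2 + c * (n + 1) * K) =
  (K + t) ^+ 2 + c * (K + t) + c * n * K by ring.
move=> rootP.
have D0 : c ^+ 2 <= c ^+ 2 - 4 * c * n * K.
  have : 0 <= - c * n * K by rewrite !mulr_ge0 //; lra.
  by lra.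
split=> [E|[_ tE]]; last first.
  by apply: rootP.2; split; [exact: le_trans (sqr_ge0 c) D0|left].
have [_ root] := rootP.1 E; split; last first.
  (* The square root is at least [- c], so the minus sign would give [t <= - K < 0]. *)
  have := ler_wsqrtr D0; rewrite sqrtr_sqr ltr0_norm // => u_ge.
  by case: root => // tE; lra.
(* Beyond the bound, [t ^+ 2], [(2 * K + c) * t] and [K * (K + c * (n + 1))] are nonnegative and the
   last is positive, so their sum cannot be 0. *)
rewrite leNgt; apply/negP => large; clear root rootP D0.
have cn : 0 <= - c * n by apply: mulr_ge0; lra.
have : 0 < K * (K + c * (n + 1)) by apply: mulr_gt0 => //; lra.
have : 0 <= (2 * K + c) * t by apply: mulr_ge0 => //; lra.
by have := sqr_ge0 t; lra.
Qed.

End Roots.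

(** * The four cases, by the signs of [c] and [e2] *)

Theorem corollary1p16 (R : realType) (r : nat) (c : R) (I : set R)
    (gamma N B : R -> 'rV[R]_4) (e1 e2 e3 kappa tau : R)
    (hr : (3 <= r)%N) (hc : c != 0)
    (hgamma : helix3 c I gamma N B e1 e2 e3 kappa tau) :
  [/\ (0 < c -> e2 = 1 ->
        (proper_r_harmonic c r I gamma <->
         [\/ (3 < r)%N /\ kappa ^+ 2 = tau ^+ 2,
             kappa ^+ 2 >= c * (r%:R - 1) /\
             (tau ^+ 2 = (2 * kappa ^+ 2 - c
                + Num.sqrt (c ^+ 2 + 4 * c * (r%:R - 2) * kappa ^+ 2)) / 2 \/
              tau ^+ 2 = (2 * kappa ^+ 2 - c
                - Num.sqrt (c ^+ 2 + 4 * c * (r%:R - 2) * kappa ^+ 2)) / 2)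
           | kappa ^+ 2 < c * (r%:R - 1) /\
             tau ^+ 2 = (2 * kappa ^+ 2 - c
                + Num.sqrt (c ^+ 2 + 4 * c * (r%:R - 2) * kappa ^+ 2)) / 2])),
      (0 < c -> e2 = -1 -> ~ proper_r_harmonic c r I gamma),
      (c < 0 -> e2 = 1 ->
        (proper_r_harmonic c r I gamma <->
         ((3 < r)%N /\ kappa ^+ 2 = tau ^+ 2) \/
         (kappa ^+ 2 <= - (c / (4 * (r%:R - 2))) /\
          (tau ^+ 2 = (2 * kappa ^+ 2 - c
             + Num.sqrt (c ^+ 2 + 4 * c * (r%:R - 2) * kappa ^+ 2)) / 2 \/
           tau ^+ 2 = (2 * kappa ^+ 2 - c
             - Num.sqrt (c ^+ 2 + 4 * c * (r%:R - 2) * kappa ^+ 2)) / 2))))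
    & (c < 0 -> e2 = -1 ->
        (proper_r_harmonic c r I gamma <->
         kappa ^+ 2 <= - c * (r%:R - 1) /\
         tau ^+ 2 = (- 2 * kappa ^+ 2 - c
            + Num.sqrt (c ^+ 2 - 4 * c * (r%:R - 2) * kappa ^+ 2)) / 2))].
Proof.
case: r hr => [|[|[|m]]] // _.
have propE := helix_proper_r_harmonic hc hgamma m.
have [_ _ [s Is]] := frenet_domain hgamma.
have K0 : 0 < kappa ^+ 2 by rewrite exprn_gt0 // (frenet_k_gt0 hgamma Is).
have t0 : 0 <= tau ^+ 2 by exact: sqr_ge0.
have n1 : 1 <= m.+1%:R :> R by rewrite ler1n.
have -> : m.+3%:R - 1 = m.+1%:R + 1 :> R
  by rewrite -[m.+3]addn2 natrD; ring.
have -> : m.+3%:R - 2 = m.+1%:R :> R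
  by rewrite -[m.+3]addn2 natrD addrK.
split=> [c0 e2E|c0 e2E|c0 e2E|c0 e2E]; rewrite propE e2E !(mulr1, mul1r, mulN1r).
- rewrite spacelike_roots_gt0 //; split=> [[?|[?|?]]|[?|?|?]].
  + exact: Or31.
  + exact: Or32.
  + exact: Or33.
  + by left.
  + by right; left.
  + by right; right.
(* For time-like [N] the case of order above 3 would require [kappa ^+ 2 = - tau ^+ 2], against
   [0 < kappa ^+ 2]. *)
- rewrite mulrN1 !mulNr !opprK; case=> [[_]|/eqP]; first by lra.
  by apply/negP; exact: timelike_no_root.
- by rewrite spacelike_roots_lt0.
- rewrite mulrN1 !mulNr !opprK timelike_roots_lt0 // !mulNr.
  by split=> [[[_ ?]|?]|?]; [lra | | right].
Qed.
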